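(* Let $d$ be a positive integer, let $0<p<1$, and let $\{X_{\mathbf n}, \mathbf n\in\mathbb{Z}_+^d\}$ be a $d$-dimensional array of $\mathcal{H}$-valued random vectors (with no assumption on their dependence structure). If the array of real-valued random variables $\{\|X_{\mathbf n}\|^p, \mathbf n\in\mathbb{Z}_+^d\}$ is uniformly integrable in the Cesàro sense, then $$\frac{\max_{\mathbf 1\prec\mathbf k\prec\mathbf n}\left\|\sum_{\mathbf i\prec\mathbf k}X_{\mathbf i}\right\|}{|\mathbf n|^{1/p}}\to 0 \quad\text{in } L_p \text{ as } |\mathbf n|\to\infty .$$
   Context: $\mathcal{H}$ is a real separable Hilbert space with norm $\|\cdot\|$; all random vectors are defined on a common probability space $(\Omega,\mathcal{F},\mathbb{P})$. $\mathbb{Z}_+^d$ is the set of $d$-tuples of positive integers. For $\mathbf m=(m_1,\dots,m_d)$ and $\mathbf n=(n_1,\dots,n_d)$ in $\mathbb{Z}_+^d$, $\mathbf m\prec\mathbf n$ (equivalently $\mathbf n\succ\mathbf m$) means $m_i\le n_i$ for all $1\le i\le d$; $|\mathbf n|=\prod_{i=1}^d n_i$; $\mathbf 1=(1,\dots,1)$. Sums over $\mathbf i\prec\mathbf k$ run over $\mathbf i\in\mathbb{Z}_+^d$. A $d$-dimensional array of real-valued random variables $\{Y_{\mathbf n},\mathbf n\in\mathbb{Z}_+^d\}$ is uniformly integrable in the Cesàro sense if $$\lim_{a\to\infty}\ \sup_{\mathbf n\succ\mathbf 1}\frac{1}{|\mathbf n|}\sum_{\mathbf i\prec\mathbf n}\mathbb{E}\big(|Y_{\mathbf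 i}|\,\mathbf 1(|Y_{\mathbf i}|>a)\big)=0,$$ where $\mathbf 1(\cdot)$ denotes the indicator function. Real random variables $W_{\mathbf n}$ converge to $0$ in $L_p$ as $|\mathbf n|\to\infty$ if $\mathbb{E}|W_{\mathbf n}|^p\to 0$ as $|\mathbf n|\to\infty$, i.e. for every $\varepsilon>0$ there is $M$ such that $\mathbb{E}|W_{\mathbf n}|^p<\varepsilon$ whenever $|\mathbf n|\ge M$. *)

(* Defs.v *)
From HB Require Import structures.
From mathcomp Require Import all_boot all_order all_algebra.
From mathcomp Require Import all_classical all_reals all_analysis.

Set Implicit Arguments.
Unset Strict Implicit.
Unset Printing Implicit Defensive.

Import Order.TTheory GRing.Theory Num.Theory.
Import numFieldNormedType.Exports.

Local Open Scope classical_set_scope.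
Local Open Scope ring_scope.

(** d-tuples of positive integers. *)
Definition Zplus (d : nat) : Type := {ffun 'I_d -> {m : nat | (0 < m)%N}}.
HB.instance Definition _ (d : nat) := Choice.on (Zplus d).

Definition Zprec (d : nat) (m n : Zplus d) : Prop :=
  forall i, (val (m i) <= val (n i))%N.

Definition Zvol (d : nat) (n : Zplus d) : nat := (\prod_i val (n i))%N.

(** Every element of [Zplus d] dominates (1, ..., 1), so [Zbox n] is both
    { i | i <= n } and { i | (1, ..., 1) <= i <= n }. It is a finite set, hence
    the finitely supported big operators indexed by it are genuine finite sums
    and maxima. *)
Definition Zbox (d : nat) (n : Zplus d) : set (Zplus d) := [set i | Zprec i n].

Definition separable_space (H : topologicalType) : Prop :=
  exists2 A : set H, countable A & dense A.

(** [H] is a Hilbert space, with inner product [dot], when its complete norm is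
    the one induced by [dot]; over the reals, forms in [{dot H for idfun}] are
    the bilinear, symmetric, positive definite ones. *)
Definition norm_of_dot (R : realType) (H : completeNormedModType R)
    (dot : {dot H for idfun}) : Prop :=
  forall x : H, `|x| ^+ 2 = dot x x.

(** Measurability for the Borel sigma-algebra of [H]. *)
Definition random_vector (disp : measure_display) (T : measurableType disp)
    (R : realType) (H : normedModType R) (X : T -> H) : Prop :=
  measurable_fun [set: T] (X : T -> g_sigma_algebraType (@open H)).

(** The supremum is taken in the extended reals: it may be infinite for some
    [a]. *)
Definition cesaro_uniformly_integrable (disp : measure_display)
    (T : measurableType disp) (R : realType) (P : probability T R) (d : nat)
    (Y : Zplus d -> T -> R) : Prop :=
  (ereal_sup [set ((Zvol n)%:R^-1)%:E *
      \sum_(i \in Zbox n)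
        'E_P[fun w => (`|Y i w| * \1_[set w' | a < `|Y i w'|] w)%R]
      | n in [set: Zplus d]])%E @[a --> +oo%R] --> 0%E.

Definition cvg0_in_Lp (disp : measure_display) (T : measurableType disp)
    (R : realType) (P : probability T R) (d : nat) (p : R)
    (W : Zplus d -> T -> R) : Prop :=
  forall eps : R, 0 < eps ->
    exists M : nat, forall n : Zplus d, (M <= Zvol n)%N ->
      ('E_P[fun w => (`|W n w| `^ p)%R] < eps%:E)%E.

(** The base value 0 does not alter the maximum: norms are nonnegative and
    [Zbox n] is nonempty. *)
Definition max_partial_sum (R : realType) (H : normedModType R) (T : Type)
    (d : nat) (X : Zplus d -> T -> H) (n : Zplus d) (w : T) : R :=
  \big[Num.max/0]_(k \in Zbox n) `| \sum_(i \in Zbox k) X i w |.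

(* Main.v *)
Require Import Defs.
From HB Require Import structures.
From mathcomp Require Import all_boot all_order all_algebra.
From mathcomp Require Import all_classical all_reals all_analysis.
From mathcomp Require Import measurable_realfun.

Import Order.TTheory GRing.Theory Num.Theory.
Import numFieldNormedType.Exports.

Local Open Scope classical_set_scope.
Local Open Scope ring_scope.

(** Write N = |n|. The maximum of the norms of the partial sums is at most the sum
    of the norms [`|X i|] over the box of n. Truncate each norm at the level where
    its p-th power equals a: since t |-> t^p is subadditive for p <= 1, the p-th
    power of that sum is at most (N a^(1/p))^p = N^p a plus the sum of the tails
    [`|X i|^p 1(`|X i|^p > a)]. After division by N and integration, the second
    part is at most the Cesaro supremum at a, hence small for a fixed large a,
    uniformly in n; the first part is a N^(p - 1), which tends to 0 as p < 1. *)

(** Shifting every coordinate by one identifies the box with a product of the ordinals below the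
    coordinates of [n], which has [Zvol n] elements. The resulting list turns finitely supported
    sums into sums over a sequence. *)
Lemma Zbox_enum (d : nat) (n : Zplus d) :
  exists s : seq (Zplus d), [/\ uniq s, size s = Zvol n & Zbox n = [set` s]].
Proof.
pose g (f : {dffun forall i : 'I_d, 'I_(val (n i))}) : Zplus d :=
  [ffun i => exist (fun m => is_true (0 < m)%N) (f i).+1 (ltn0Sn _)].
have g_inj : injective g.
  move=> f1 f2 /ffunP f12; apply/ffunP => i; apply/val_inj.
  by have := congr1 val (f12 i); rewrite !ffunE /= => -[].
exists (map g (enum {: {dffun forall i : 'I_d, 'I_(val (n i))}})); split.
- by rewrite map_inj_uniq// enum_uniq.
- rewrite size_map -cardE card_dep_ffun /Zvol foldrE big_map big_enum.
  by apply: eq_bigr => i _; rewrite card_ord.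
- apply/seteqP; split => [k kn|k /= /mapP[f _ ->] i]; last by rewrite ffunE /=.
  have kn1 i : ((val (k i)).-1 < val (n i))%N by rewrite prednK ?(valP (k i)) ?kn.
  apply/mapP; exists [ffun i => Ordinal (kn1 i)]; first by rewrite mem_enum.
  by apply/ffunP => i; apply/val_inj; rewrite !ffunE /= prednK ?(valP (k i)).
Qed.

Lemma powR_ge0_leD (R : realType) (p x y : R) : 0 < p -> p <= 1 ->
  0 <= x -> 0 <= y -> (x + y) `^ p <= x `^ p + y `^ p.
Proof.
move=> p0 p1 x0 y0.
have [xy0|xy0] := eqVneq (x + y) 0.
  by rewrite xy0 powR0 ?gt_eqF// addr_ge0 ?powR_ge0.
have xy_gt0 : 0 < x + y by rewrite lt_neqAle eq_sym xy0 addr_ge0.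
(* [t <= t `^ p] on [0, 1], applied to the shares [x / (x + y)], [y / (x + y)] *)
have share (z : R) : 0 <= z -> z <= x + y -> z / (x + y) * (x + y) `^ p <= z `^ p.
  rewrite le_eqVlt => /predU1P[<- _|z0 zxy]; first by rewrite !mul0r powR_ge0.
  have zE : z = z / (x + y) * (x + y) by rewrite divfK.
  rewrite [in leRHS]zE powRM ?divr_ge0 ?(ltW z0) ?(ltW xy_gt0)//.
  rewrite ler_wpM2r ?powR_ge0// ger1_powR//.
  by rewrite divr_gt0//= ler_pdivrMr// mul1r.
rewrite -[leLHS]mul1r -[X in X * _](divff xy0) mulrDl mulrDl.
by apply: lerD; apply: share; rewrite ?lerDl ?lerDr.
Qed.

Lemma powR_ge0_le_sum (R : realType) (I : Type) (s : seq I) (u : I -> R) (p : R) :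
  0 < p -> p <= 1 -> (forall i, 0 <= u i) ->
  (\sum_(i <- s) u i) `^ p <= \sum_(i <- s) u i `^ p.
Proof.
move=> p0 p1 u0; elim: s => [|i s IH].
  by rewrite !big_nil powR0 ?gt_eqF.
rewrite !big_cons; apply: le_trans (powR_ge0_leD _ _ _ _ _ _ _ _) _ => //.
  by rewrite sumr_ge0.
by rewrite lerD2l.
Qed.

Lemma powR_sum_le_truncation (R : realType) (I : Type) (s : seq I) (u : I -> R)
    (p a : R) : 0 < p -> p <= 1 -> 0 <= a -> (forall i, 0 <= u i) ->
  (\sum_(i <- s) u i) `^ p <=
    (size s)%:R `^ p * a + \sum_(i <- s) u i `^ p * (a < u i `^ p)%R%:R.
Proof.
move=> p0 p1 a0 u0; have pN0 : p != 0 by rewrite gt_eqF.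
(* If (u i)^p <= a, taking p-th roots bounds [u i] by the first term; otherwise the indicator is 1
   and the second term is [u i] itself. *)
have split_u i : u i <= a `^ p^-1 + u i * (a < u i `^ p)%R%:R.
  case: ltP => ua; rewrite ?mulr1 ?mulr0 ?addr0 ?lerDr ?powR_ge0//.
  rewrite -[u i](powRr1 (u0 i)) -(divff pN0) powRrM.
  by apply: ge0_ler_powR; rewrite ?invr_ge0 ?(ltW p0) ?nnegrE ?powR_ge0.
have tail_ge0 i : 0 <= u i * (a < u i `^ p)%R%:R by rewrite mulr_ge0.
have : (\sum_(i <- s) u i) `^ p <=
    ((size s)%:R * a `^ p^-1 + \sum_(i <- s) u i * (a < u i `^ p)%R%:R) `^ p.
  apply: ge0_ler_powR; rewrite ?nnegrE ?(ltW p0) ?sumr_ge0//.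
    by rewrite addr_ge0 ?mulr_ge0 ?powR_ge0 ?sumr_ge0.
  apply: le_trans (ler_sum _ (fun i _ => split_u i)) _.
  by rewrite big_split/= big_const_seq count_predT iter_addr_0 mulr_natl.
move=> /le_trans; apply; apply: le_trans (powR_ge0_leD _ _ _ _ p0 p1 _ _) _.
- by rewrite mulr_ge0 ?powR_ge0.
- by rewrite sumr_ge0.
rewrite powRM ?powR_ge0// -powRrM mulVf// powRr1// lerD2l.
apply: le_trans (powR_ge0_le_sum _ _ _ _ _ p0 p1 tail_ge0) _.
(* An indicator takes the values 0 and 1, so it equals its own p-th power for p > 0. *)
apply: ler_sum => i _; rewrite powRM//.
by case: (a < _); rewrite ?powR1// powR0.
Qed.

(** The operator folds over a finite list that is either empty or contained in [A]; the condition on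
    [c] takes care of the base value 0. *)
Lemma fsbig_max_le (R : realType) (I : choiceType) (A : set I) (F : I -> R) (c : R) :
  0 <= c -> (forall i, A i -> F i <= c) -> \big[Num.max/0]_(i \in A) F i <= c.
Proof.
move=> c0 Fc; rewrite big_seq; apply: (big_ind (fun x => x <= c)) => //.
  by move=> x y xc yc; rewrite ge_max xc.
move=> i; case: finite_supportP => // X XA _ _ iX.
by apply: Fc; apply: XA.
Qed.

Lemma max_partial_sum_le (R : realType) (H : normedModType R) (T : Type) (d : nat)
    (X : Zplus d -> T -> H) (n : Zplus d) (w : T) (s : seq (Zplus d)) :
  uniq s -> Zbox n = [set` s] ->
  max_partial_sum X n w <= \sum_(i <- s) `|X i w|.
Proof.
move=> us nE; apply: fsbig_max_le => [|k kn]; first by rewrite sumr_ge0.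
have [t [ut _ kE]] := Zbox_enum _ k; rewrite kE -fsbig_seq//.
apply: le_trans (ler_norm_sum _ _ _) _.
(* As k <= n, the box of [k] lies in that of [n]: its sum is the sum over [s] with the terms outside
   [t] replaced by 0, which only decreases it. *)
have ts : perm_eq t [seq i <- s | i \in t].
  apply: uniq_perm; rewrite ?filter_uniq// => i; rewrite mem_filter.
  have [it|//] := boolP (i \in t); apply/esym.
  suff : Zbox n i by rewrite nE.
  have ki : Zbox k i by rewrite kE.
  by move=> j; apply: leq_trans (ki j) (kn j).
rewrite (perm_big _ ts) big_filter big_mkcond /=.
by apply: ler_sum => i _; case: ifP.
Qed.

Lemma max_partial_sum_ge0 (R : realType) (H : normedModType R) (T : Type) (d : nat)
    (X : Zplus d -> T -> H) (n : Zplus d) (w : T) : 0 <= max_partial_sum X n w.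
Proof.
apply: (big_ind (fun x => 0 <= x)) => // x y x0 _.
by rewrite le_max x0.
Qed.

(* [ge0_le_integral] requires both functions to be measurable; this version spares
   a proof that the maximum of the partial sums is. *)
Lemma ge0_le_integral_nonmeasurable (disp : measure_display) (T : measurableType disp)
    (R : realType) (mu : {measure set T -> \bar R}) (f g : T -> \bar R) :
  (forall w, 0 <= f w)%E -> (forall w, f w <= g w)%E ->
  (\int[mu]_w f w <= \int[mu]_w g w)%E.
Proof.
move=> f0 fg; rewrite !ge0_integralTE//; last by move=> w; exact: le_trans (fg w).
apply: le_ereal_sup => _ /= [h hf <-]; exists h => // w.
exact: le_trans (fg w).
Qed.

(** Open intervals generate the Borel sets of the line, and the continuous norm pulls them back to
    open sets of [H]. *)
Lemma measurable_norm_random_vector (disp : measure_display) (T : measurableType disp)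
    (R : realType) (H : normedModType R) (X : T -> H) :
  random_vector X -> measurable_fun [set: T] (fun w => `|X w|).
Proof.
move=> mX; apply: (measurability _ (RGenOpens.measurableE R)) => _ [_ [a [b ->] <-]].
have -> : (fun w => `|X w|) @^-1` `]a, b[%classic =
    X @^-1` ((fun x : H => `|x|) @^-1` `]a, b[%classic) by [].
apply: mX => //; apply: sub_sigma_algebra.
by move: (@norm_continuous _ H) => /continuousP; apply; exact: interval_open.
Qed.

Lemma integral_cst_add_sum (disp : measure_display) (T : measurableType disp)
    (R : realType) (P : probability T R) (I : Type) (s : seq I) (g : I -> T -> R)
    (b c : R) : 0 <= b -> 0 <= c ->
  (forall i, measurable_fun [set: T] (g i)) -> (forall i w, 0 <= g i w) ->
  (\int[P]_w (b + c * \sum_(i <- s) g i w)%:E =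
   b%:E + c%:E * \sum_(i <- s) \int[P]_w (g i w)%:E)%E.
Proof.
move=> b0 c0 mg g0.
under eq_integral do rewrite EFinD EFinM -sumEFin.
have ms : measurable_fun [set: T] (fun w => \sum_(i <- s) (g i w)%:E)%E.
  by apply: emeasurable_sum => i; exact/measurable_EFinP.
have s0 w : (0 <= \sum_(i <- s) (g i w)%:E)%E by apply: sume_ge0 => i _; rewrite lee_fin.
rewrite ge0_integralD//=; last first.
- exact: measurable_funeM.
- by move=> w _; rewrite mule_ge0.
rewrite integral_cst// [X in (_ * X)%E]probability_setT mule1.
rewrite ge0_integralZl_EFin// ge0_integral_sum//.
- by move=> i; exact/measurable_EFinP.
- by move=> i w _; rewrite lee_fin.
Qed.

Lemma exists_nat_powR_lt (R : realType) (q a eps : R) : 0 < q -> 0 < eps ->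
  exists M : nat, forall N : nat, (M <= N)%N -> (0 < N)%N -> a * N%:R `^ (- q) < eps.
Proof.
(* This [M] exceeds the q-th root of a / eps, so N^q > a / eps from there on. The maximum with 0
   covers negative [a], where the root would not be inverted by the q-th power. *)
move=> q0 eps0; exists (Num.truncn (Num.max 0 (a / eps) `^ q^-1)).+1 => N MN N0.
have Nq : 0 < N%:R `^ q :> R by rewrite powR_gt0 ?ltr0n.
rewrite powRN ltr_pdivrMr// mulrC -ltr_pdivrMr//.
have : Num.max 0 (a / eps) `^ q^-1 < N%:R.
  apply: lt_le_trans (truncnS_gt _) _; by rewrite ler_nat.
move=> /(gt0_ltr_powR q0); rewrite !nnegrE powR_ge0 ler0n => /(_ isT isT).
rewrite -powRrM mulVf ?gt_eqF// powRr1 ?le_max ?lexx//; apply: le_lt_trans.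
by rewrite le_max lexx orbT.
Qed.

Theorem theorem1 (R : realType)
    (H : completeNormedModType R) (dot : {dot H for idfun})
    (Hdot : norm_of_dot dot) (Hsep : separable_space H)
    (disp : measure_display) (T : measurableType disp) (P : probability T R)
    (d : nat) (hd : (0 < d)%N) (p : R) (hp0 : 0 < p) (hp1 : p < 1)
    (X : Zplus d -> T -> H) (HX : forall n : Zplus d, random_vector (X n)) :
  cesaro_uniformly_integrable P (fun (n : Zplus d) (w : T) => `|X n w| `^ p) ->
  cvg0_in_Lp P p
    (fun (n : Zplus d) (w : T) =>
       max_partial_sum X n w / ((Zvol n)%:R `^ (1 / p))).
Proof.
move=> ui eps eps0; have eps20 : 0 < eps / 2 by rewrite divr_gt0.
have eps20E : (0 < (eps / 2)%:E)%E by rewrite lte_fin.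
have near_a := ui _ (open_ereal_lt' eps20E).
(* The supremum over n is already inside the limit, so one level [a] serves every n. *)
have [a [a0 Fa]] : exists a : R, 0 < a /\
   (ereal_sup [set ((Zvol n)%:R^-1)%:E *
      \sum_(i \in Zbox n)
        'E_P[fun w => (`| `|X i w| `^ p| * \1_[set w' | a < `| `|X i w'| `^ p|%R] w)%R]
      | n in [set: Zplus d]] < (eps / 2)%:E)%E.
  near (+oo%R : set_system R) => a; exists a; split; first by near: a; exact: nbhs_pinfty_gt.
  by near: a.
have p1_gt0 : 0 < 1 - p by rewrite subr_gt0.
have [M MP] := exists_nat_powR_lt _ _ a _ p1_gt0 eps20.
exists M => n Mn; have [s [us ss nE]] := Zbox_enum _ n.
have N0 : (0 < Zvol n)%N by rewrite prodn_gt0// => i; exact: (valP (n i)).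
set N : R := (Zvol n)%:R; have Ngt0 : 0 < N by rewrite ltr0n.
(* The tail in the form given by the truncation bound; [gE] matches it with the integrand of the
   Cesaro condition. *)
pose g i w : R := `|X i w| `^ p * (a < `|X i w| `^ p)%R%:R.
have g0 i w : 0 <= g i w by rewrite mulr_ge0 ?powR_ge0.
have mY i : measurable_fun [set: T] (fun w => `|X i w| `^ p).
  apply: (measurableT_comp (measurable_powR p)); exact: measurable_norm_random_vector.
have gE i w : g i w =
    `| `|X i w| `^ p| * \1_[set w' | a < `| `|X i w'| `^ p|%R] w.
  rewrite /g indicE ger0_norm ?powR_ge0//; congr (_ * (nat_of_bool _)%:R).
  by apply/idP/idP; rewrite inE /= ger0_norm ?powR_ge0.
have mg i : measurable_fun [set: T] (g i).
  rewrite (_ : g i = fun w => `|X i w| `^ p * \1_[set w' | a < `|X i w'| `^ p] w).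
    apply: measurable_funM => //; apply: measurable_indic.
    rewrite -[X in measurable X]setTI (_ : [set _ | _] =
      (fun w => `|X i w| `^ p) @^-1` `]a, +oo[%classic); first exact: mY.
    by apply/seteqP; split => w /=; rewrite in_itv/= andbT.
  apply/funext => w; rewrite gE indicE [in RHS]indicE ger0_norm ?powR_ge0//.
  congr (_ * (nat_of_bool (_ \in _))%:R).
  by apply/funext => w'; rewrite /= ger0_norm ?powR_ge0.
have W_le w : `|max_partial_sum X n w / N `^ (1 / p)| `^ p <=
    a * N `^ (- (1 - p)) + N^-1 * \sum_(i <- s) g i w.
  rewrite ger0_norm ?divr_ge0 ?powR_ge0 ?max_partial_sum_ge0//.
  rewrite powRM ?invr_ge0 ?powR_ge0 ?max_partial_sum_ge0// -powRN -powRrM.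
  rewrite mulNr div1r mulVf ?gt_eqF// powR_inv1 ?(ltW Ngt0)// mulrC.
  (* The p-th power has turned division by N^(1/p) into division by N. Extracting N^-1 from the
     right-hand side too leaves the truncation bound for a list of length N. *)
  have -> : a * N `^ (- (1 - p)) = N^-1 * (N `^ p * a).
    rewrite opprB powRB ?(gt_eqF Ngt0) ?implybT// powRr1 ?(ltW Ngt0)//.
    by rewrite mulrA mulrC (mulrC a).
  rewrite -mulrDr ler_pM2l ?invr_gt0// /N -ss.
  apply: le_trans (powR_sum_le_truncation _ _ _ _ _ _ hp0 (ltW hp1) (ltW a0) _) => //.
  apply: ge0_ler_powR; rewrite ?nnegrE ?(ltW hp0) ?max_partial_sum_ge0 ?sumr_ge0//.
  exact: max_partial_sum_le.
rewrite unlock.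
apply: le_lt_trans (ge0_le_integral_nonmeasurable _ _ _ _ _
  (fun w => (a * N `^ (- (1 - p)) + N^-1 * \sum_(i <- s) g i w)%:E) _ _) _.
- by move=> w; rewrite lee_fin powR_ge0.
- by move=> w; rewrite lee_fin.
rewrite integral_cst_add_sum ?mulr_ge0 ?powR_ge0 ?(ltW a0) ?invr_ge0 ?(ltW Ngt0)//.
(* The choice of [M] makes the constant part less than eps / 2; the averaged tails are the member of
   index [n] of the family whose supremum is below eps / 2. *)
rewrite [eps]splitr EFinD lteD ?lte_fin ?MP//; apply: le_lt_trans Fa.
apply: ereal_sup_ubound; exists n => //; rewrite nE -fsbig_seq//; congr (_ * _)%E.
apply: eq_bigr => i _; rewrite unlock; apply: eq_integral => w _.
by rewrite gE.
Unshelve. all: by end_near. Qed.
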